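(* If $\xi\neq 0$, then $\operatorname{sign}\big(\eta(-\tilde A^{-1}\tilde b)\big)=-\operatorname{sign}(\xi)$. Furthermore, letting $\mathcal{E}$ be the set of equilibria of the closed-loop system $\dot x=F(x)$: 1. if $\xi\neq 0$ and $\eta(-\tilde A^{-1}\tilde b)>0$ (or equivalently, $\xi<0$), then $\mathcal{E}=\{0\}$; 2. if $\xi\neq 0$ and $\eta(-\tilde A^{-1}\tilde b)<0$ (or equivalently, $\xi>0$), then $\mathcal{E}=\{0\}\cup\{-\tilde A^{-1}\tilde b\}$; 3. if $\xi=0$, then $\mathcal{E}=\{0\}\cup\{x\in\mathbb{R}^n:\tilde A x=-\tilde b,\ \eta(x)<0\}$. In particular, if $\tilde b\in\operatorname{Im}(\tilde A)$, then $\mathcal{E}$ contains infinitely many points, whereas if $\tilde b\notin\operatorname{Im}(\tilde A)$, then $\mathcal{E}=\{0\}$.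
   Context: Data: $A\in\mathbb{R}^{n\times n}$, $B\in\mathbb{R}^{n\times m}$ with $(A,B)$ stabilizable; $c\in\mathbb{R}^n$, $d\in\mathbb{R}$ with $d>0$; $h(x)=c^\top x+d$. The integer $r\ge 1$ is the relative degree of $h$ for $\dot x=Ax+Bu$: $c^\top A^iB=0$ for $0\le i\le r-2$ and $c^\top A^{r-1}B\neq 0$. $\alpha_1,\dots,\alpha_r>0$ are constants and $\alpha=\prod_{i=1}^r\alpha_i$. $G\in\mathbb{R}^{m\times m}$ is symmetric positive definite. $K\in\mathbb{R}^{m\times n}$ is a nominal gain such that $A_0:=A-BK$ is Hurwitz (all eigenvalues have negative real part). Notation: $\phi(s)=\prod_{j=1}^{r}(s+\alpha_j)$; $\theta=c^\top A^{r-1}B\,G^{-1}B^\top(A^\top)^{r-1}c>0$; $v_1=-\frac{1}{\theta}B\,G^{-1}B^\top(A^\top)^{r-1}c$; $v_2^\top=c^\top(\phi(A)-A^{r-1}BK)$; $\tilde A=A_0+v_1v_2^\top$; $\tilde b=\alpha d\,v_1$; $\eta(x)=v_2^\top x+\alpha d$; $\xi=c^\top A_0^{-1}B\,G^{-1}B^\top(A^\top)^{r-1}c$. The matrix $\tilde A$ is invertible whenever $\xi\ne0$, so the expressions involving $\tilde A^{-1}$ are meaningful. Closed-loop system: $\dot x=F(x)$ with $F(x)=A_0x$ if $\eta(x)\ge 0$ and $F(x)=\tilde A x+\tilde b$ if $\eta(x)<0$. It arises from $\dot x=Ax+Bu^*(x)$, where $u^*(x)$ is the safety filter, i.e. the minimizer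 of $\frac12 (u+Kx)^\top G(u+Kx)$ over $u\in\mathbb{R}^m$ subject to $c^\top\phi(A)x+c^\top A^{r-1}Bu+\alpha d\ge 0$. An equilibrium is a point $x$ with $F(x)=0$. For real $z$, $\operatorname{sign}(z)=1,-1,0$ according to $z>0$, $z<0$, $z=0$. *)

(* Defs.v *)
From HB Require Import structures.
From mathcomp Require Import all_boot all_order all_algebra.
From mathcomp Require Import boolp classical_sets functions cardinality reals.
From mathcomp.real_closed Require Import complex.

Set Implicit Arguments.
Unset Strict Implicit.
Unset Printing Implicit Defensive.

Import Order.TTheory GRing.Theory Num.Theory.
Local Open Scope ring_scope.
Local Open Scope classical_set_scope.

(* [eigenvalue] only sees the base field, so the matrix is first embedded into
   the complex matrices: all complex eigenvalues are constrained. *)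
Definition hurwitz (R : realType) (n : nat) (M : 'M[R]_n) : Prop :=
  forall z : R[i], eigenvalue (map_mx (real_complex R) M) z -> complex.Re z < 0.

Definition stabilizable (R : realType) (n m : nat)
    (A : 'M[R]_n) (B : 'M[R]_(n, m)) : Prop :=
  exists K : 'M[R]_(m, n), hurwitz (A - B *m K).

Definition sym_posdef (R : realType) (m : nat) (G : 'M[R]_m) : Prop :=
  G^T = G /\ forall u : 'cV[R]_m, u != 0 -> 0 < (u^T *m G *m u) 0 0.

(* The condition 0 <= i <= r - 2 is written i + 2 <= r, so that it is empty
   when r = 1 in spite of truncated subtraction. *)
Definition relative_degree (R : realType) (n m : nat)
    (A : 'M[R]_n) (B : 'M[R]_(n, m)) (c : 'cV[R]_n) (r : nat) : Prop :=
  [/\ (1 <= r)%N,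
      forall i : nat, (i + 2 <= r)%N -> c^T *m A ^+ i *m B = 0
    & c^T *m A ^+ r.-1 *m B != 0].

Section ClosedLoop.

(* The state dimension is n.+1, which is what polynomial evaluation at a
   matrix ([horner_mx]) requires. Dimension 0 has no relative degree. *)
Variables (R : realType) (n m r : nat).
Variables (A : 'M[R]_n.+1) (B : 'M[R]_(n.+1, m)) (c : 'cV[R]_n.+1) (d : R).
Variables (alpha : 'I_r -> R) (G : 'M[R]_m) (K : 'M[R]_(m, n.+1)).

Definition alpha_prod : R := \prod_(j < r) alpha j.

Definition phi : {poly R} := \prod_(j < r) ('X + (alpha j)%:P).

Definition A0 : 'M[R]_n.+1 := A - B *m K.

(* B G^-1 B^T (A^T)^(r-1) c *)
Definition safe_dir : 'cV[R]_n.+1 :=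
  B *m invmx G *m B^T *m A^T ^+ r.-1 *m c.

Definition theta : R := (c^T *m A ^+ r.-1 *m safe_dir) 0 0.

Definition xi : R := (c^T *m invmx A0 *m safe_dir) 0 0.

Definition v1 : 'cV[R]_n.+1 := - theta^-1 *: safe_dir.

(* v2 transposed *)
Definition v2T : 'rV[R]_n.+1 :=
  c^T *m (horner_mx A phi - A ^+ r.-1 *m B *m K).

Definition Atilde : 'M[R]_n.+1 := A0 + v1 *m v2T.

Definition btilde : 'cV[R]_n.+1 := (alpha_prod * d) *: v1.

(* the function eta of the switching condition *)
Definition switching (x : 'cV[R]_n.+1) : R := (v2T *m x) 0 0 + alpha_prod * d.

Definition closed_loop (x : 'cV[R]_n.+1) : 'cV[R]_n.+1 :=
  if 0 <= switching x then A0 *m x else Atilde *m x + btilde.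

Definition equilibria : set 'cV[R]_n.+1 := [set x | closed_loop x = 0].

End ClosedLoop.

Arguments safe_dir {R n m} r A B c G.
Arguments theta {R n m} r A B c G.
Arguments xi {R n m} r A B c G K.
Arguments v1 {R n m} r A B c G.

(* Main.v *)
Require Import Defs.
From HB Require Import structures.
From mathcomp Require Import all_boot all_order all_algebra.
From mathcomp Require Import boolp classical_sets functions cardinality reals.
From mathcomp.real_closed Require Import complex.
From mathcomp Require Import ring.
Import Order.TTheory GRing.Theory Num.Theory.
Local Open Scope ring_scope.
Local Open Scope classical_set_scope.

Set Implicit Arguments.
Unset Strict Implicit.
Unset Printing Implicit Defensive.

(** On the filtered side of the switching surface the vector field is
    A0 x + eta(x) v1: the nominal field corrected along v1 by an amount
    proportional to the constraint violation. Its zeros therefore satisfy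
    x = - eta(x) A0^-1 v1, and applying v2T closes a scalar loop,
        eta(x) = - eta(x) (v2T A0^-1 v1) + alpha d,
    where alpha is the product of the alpha_j. Everything depends on the loop
    gain v2T A0^-1 v1.

    To compute it, write phi(s) = psi(s) s + alpha with psi monic of degree
    r - 1. The relative degree gives c^T psi(A) B = c^T A^(r-1) B, hence
        v2T = c^T psi(A) A0 + alpha c^T              ([v2TE]),
    and, v1 being a multiple of the direction w = B G^-1 B^T (A^T)^(r-1) c,
    on which c^T psi(A) takes the value theta and c^T A0^-1 the value xi,
        v2T A0^-1 v1 = - (1 + alpha xi / theta)      ([v2T_invA0_v1]).

    The scalar loop thus becomes eta(x) xi = - d theta < 0 at every zero x of
    the filtered field, whichever side of the surface x lies on
    ([switching_filtered_zero]). If xi is nonzero, the homogeneous version of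
    the argument shows that Atilde is invertible ([Atilde_unitmx]); the unique
    zero has eta of sign opposite to xi, so it is an equilibrium of the
    switched system exactly when xi > 0. If xi = 0, the filtered field has no
    zero at all: btilde is never in the image of Atilde, and the origin, which
    lies on the nominal side because alpha d > 0, is the only equilibrium. *)

(** * Positive definite and Hurwitz matrices *)

Section PositiveDefinite.
Variables (R : realType) (m : nat) (G : 'M[R]_m).
Hypothesis hG : sym_posdef G.

Lemma sym_posdef_unitmx : G \in unitmx.
Proof.
have [_ Gpos] := hG; rewrite -row_free_unit -kermx_eq0.
apply/eqP/row_matrixP => i; rewrite row0; apply/eqP; apply: contraT => ker_i.
have /Gpos : (row i (kermx G))^T != 0 by rewrite trmx_eq0.
by rewrite trmxK -row_mul mulmx_ker row0 mul0mx mxE ltxx.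
Qed.

(** The form of G^-1 at u is the form of G at G^-1 u. *)
Lemma sym_posdef_inv_gt0 (u : 'cV[R]_m) :
  u != 0 -> 0 < (u^T *m invmx G *m u) 0 0.
Proof.
have [Gsym Gpos] := hG; have Gu := sym_posdef_unitmx => u_neq0.
have -> : u^T *m invmx G *m u = (invmx G *m u)^T *m G *m (invmx G *m u).
  by rewrite trmx_mul trmx_inv Gsym -!mulmxA mulKVmx.
apply: Gpos; apply: contra u_neq0 => /eqP Gu0.
by rewrite -(mulKVmx Gu u) Gu0 mulmx0.
Qed.

End PositiveDefinite.

(** A singular matrix has the eigenvalue 0, whose real part is not negative. *)
Lemma hurwitz_unitmx (R : realType) (n : nat) (M : 'M[R]_n) :
  hurwitz M -> M \in unitmx.
Proof.
move=> hM; rewrite -(map_unitmx (real_complex R)) -row_free_unit -kermx_eq0.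
apply: contraT => ker_neq0.
have /hM : eigenvalue (map_mx (real_complex R) M) 0.
  by rewrite /eigenvalue /eigenspace raddf0 subr0.
by rewrite ltxx.
Qed.

(** * The loop gain *)

Lemma horner_mx_coef (R : comNzRingType) (n : nat) (M : 'M[R]_n.+1)
    (p : {poly R}) (k : nat) :
  (size p <= k)%N -> horner_mx M p = \sum_(i < k) p`_i *: M ^+ i.
Proof.
move=> sp; rewrite [in LHS](_ : p = \poly_(i < k) p`_i); last first.
  apply/polyP => i; rewrite coef_poly; case: ltnP => // ki.
  by rewrite nth_default // (leq_trans sp).
rewrite poly_def linear_sum /=; apply: eq_bigr => i _.
by rewrite linearZ /= rmorphXn /= horner_mx_X.
Qed.

(** The scalar loop at a zero of the filtered field: here s stands for v2T x,
    and s + a d for the switching function. *)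
Lemma gain_fixpoint (F : fieldType) (s a d y t : F) :
  a != 0 -> t != 0 -> s = (s + a * d) * (1 + a * y / t) ->
  (s + a * d) * y = - (d * t).
Proof.
move=> a_neq0 t_neq0 sE; apply/eqP; rewrite -addr_eq0.
have /eqP : a / t * ((s + a * d) * y + d * t) = 0.
  by rewrite -(subrr s) {2}sE; field.
by rewrite !mulf_eq0 invr_eq0 (negPf a_neq0) (negPf t_neq0).
Qed.

Section ClosedLoopTheory.

Variables (R : realType) (n m r : nat).
Variables (A : 'M[R]_n.+1) (B : 'M[R]_(n.+1, m)) (c : 'cV[R]_n.+1) (d : R).
Variables (alpha : 'I_r -> R) (G : 'M[R]_m) (K : 'M[R]_(m, n.+1)).

Local Notation A0 := (A0 A B K).
Local Notation w := (safe_dir r A B c G).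
Local Notation theta := (theta r A B c G).
Local Notation xi := (xi r A B c G K).
Local Notation v1 := (v1 r A B c G).
Local Notation v2T := (v2T A B c alpha K).
Local Notation At := (Atilde A B c alpha G K).
Local Notation bt := (btilde A B c d alpha G).
Local Notation eta := (switching A B c d alpha K).
Local Notation prod_alpha := (alpha_prod alpha).

Lemma alpha_prod_gt0 : (forall j, 0 < alpha j) -> 0 < prod_alpha.
Proof. by move=> halpha; apply: prodr_gt0. Qed.

Lemma phi_prodXsubC :
  phi alpha = \prod_(a <- [seq - alpha j | j <- index_enum 'I_r]) ('X - a%:P).
Proof. by rewrite big_map; apply: eq_bigr => j _; rewrite polyCN opprK. Qed.

(** The polynomial psi of phi(s) = psi(s) s + alpha. *)
Definition phi_shift : {poly R} := drop_poly 1 (phi alpha).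

Lemma size_phi : size (phi alpha) = r.+1.
Proof.
rewrite phi_prodXsubC size_prod_XsubC size_map.
by rewrite -[index_enum _]enumT size_enum_ord.
Qed.

Lemma size_phi_shift : size phi_shift = r.
Proof. by rewrite size_drop_poly size_phi subn1. Qed.

Lemma lead_phi_shift : (0 < r)%N -> phi_shift`_r.-1 = 1.
Proof.
move=> r_gt0; rewrite coef_drop_poly addn1 prednK //.
have /monicP : phi alpha \is monic by rewrite phi_prodXsubC monic_prod_XsubC.
by rewrite lead_coefE size_phi.
Qed.

Lemma phiE : phi alpha = phi_shift * 'X + prod_alpha%:P.
Proof.
rewrite -[LHS](poly_take_drop 1) addrC expr1; congr (_ + _).
rewrite /take_poly poly_def big_ord_recl big_ord0 addr0 expr0 alg_polyC /=.
rewrite -horner_coef0 horner_prod; congr _%:P.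
by apply: eq_bigr => j _; rewrite !hornerE.
Qed.

(** The offset btilde is collinear to v1, so it merges with the rank-one term
    of Atilde into a single correction governed by the switching function. *)
Lemma filtered_fieldE x : At *m x + bt = A0 *m x + eta x *: v1.
Proof.
rewrite /Atilde /btilde /switching mulmxDl -addrA scalerDl; congr (_ + (_ + _)).
by rewrite -mulmxA [v2T *m x in LHS]mx11_scalar mul_mx_scalar.
Qed.

Section RelativeDegree.
Hypothesis hr : relative_degree A B c r.

(** Only the term of degree r - 1 survives, since the lower Markov parameters
    c^T A^i B vanish. *)
Lemma row_horner_B (p : {poly R}) : (size p <= r)%N ->
  c^T *m horner_mx A p *m B = p`_r.-1 *: (c^T *m A ^+ r.-1 *m B).
Proof.
have [r_gt0 vanish _] := hr.
move=> sp; rewrite (horner_mx_coef _ sp) mulmx_sumr mulmx_suml.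
have lt_r : (r.-1 < r)%N by rewrite prednK.
rewrite (bigD1 (Ordinal lt_r)) //= big1 ?addr0 => [|i i_neq].
  by rewrite -scalemxAr -scalemxAl.
rewrite -scalemxAr -scalemxAl vanish ?scaler0 // addn2.
rewrite ltn_neqAle (ltn_ord i) andbT; apply: contra i_neq => /eqP ir.
by apply/eqP/val_inj; rewrite /= -[in RHS]ir.
Qed.

(** The term A^(r-1) B K of v2T is what turns the last factor A of psi(A) A
    into A0 = A - B K, because c^T psi(A) B = c^T A^(r-1) B. This is the form
    of v2T that can be multiplied by the inverse of A0. *)
Lemma v2TE : v2T = c^T *m horner_mx A phi_shift *m A0 + prod_alpha *: c^T.
Proof.
have [r_gt0 _ _] := hr.
rewrite /Defs.v2T /Defs.A0 phiE rmorphD rmorphM /= horner_mx_X horner_mx_C.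
rewrite !mulmxBr mulmxDr mul_mx_scalar mulmxA.
rewrite [X in _ = _ - X + _]mulmxA row_horner_B ?size_phi_shift //.
by rewrite lead_phi_shift // scale1r !mulmxA addrAC.
Qed.

Lemma row_phi_shift_dir : (c^T *m horner_mx A phi_shift *m w) 0 0 = theta.
Proof.
have [r_gt0 _ _] := hr.
rewrite /Defs.theta /safe_dir !mulmxA row_horner_B ?size_phi_shift //.
by rewrite lead_phi_shift // scale1r.
Qed.

(** theta is the form of G^-1 at B^T (A^T)^(r-1) c, a vector that the relative
    degree makes nonzero. *)
Lemma theta_gt0 : sym_posdef G -> 0 < theta.
Proof.
move=> hG; have [_ _ CAB_neq0] := hr.
rewrite /Defs.theta /safe_dir.
set u := (c^T *m A ^+ r.-1 *m B)^T.
have uE : u = B^T *m (A^T ^+ r.-1 *m c).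
  rewrite /u !trmx_mul trmxK; congr (_ *m (_ *m _)).
  by elim: (r.-1) => [|k IHk]; rewrite ?expr0 ?trmx1 // exprSr exprS trmx_mul IHk.
have -> : c^T *m A ^+ r.-1 *m (B *m invmx G *m B^T *m A^T ^+ r.-1 *m c)
    = u^T *m invmx G *m u.
  by rewrite {2}uE trmxK !mulmxA.
by apply: sym_posdef_inv_gt0; rewrite ?trmx_eq0.
Qed.

Hypothesis uA0 : A0 \in unitmx.
Hypothesis theta_neq0 : theta != 0.

Lemma v2T_invA0_v1 :
  (v2T *m invmx A0 *m v1) 0 0 = - (1 + prod_alpha * xi / theta).
Proof.
rewrite v2TE mulmxDl mulmxK // /Defs.v1 -scalemxAr -scalemxAl mulmxDl.
rewrite -!scalemxAl mxE [X in _ * X]mxE row_phi_shift_dir [X in _ + X]mxE -/xi.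
by rewrite mulNr mulrDr mulVf // mulrC.
Qed.

(** * Zeros of the filtered field *)

(** The response of v2T to a constant input s along v1. The value of s is left
    free: it is eta(x) for the zeros of the affine field and v2T x for the
    kernel of Atilde. *)
Lemma v2T_steady_state x (s : R) :
  A0 *m x + s *: v1 = 0 -> (v2T *m x) 0 0 = s * (1 + prod_alpha * xi / theta).
Proof.
move=> /eqP; rewrite addr_eq0 => /eqP A0x.
rewrite -(mulKmx uA0 x) A0x mulmxN -scalemxAr mulmxN -scalemxAr mulmxA.
by rewrite mxE [X in - X]mxE v2T_invA0_v1 mulrN opprK.
Qed.

(** This identity decides the sign of the switching function when xi is
    nonzero, and excludes any zero when xi = 0. *)
Lemma switching_filtered_zero x : prod_alpha != 0 ->
  At *m x + bt = 0 -> eta x * xi = - (d * theta).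
Proof.
move=> alpha_neq0; rewrite filtered_fieldE => /v2T_steady_state; rewrite /switching.
exact: gain_fixpoint.
Qed.

(** On the kernel of Atilde the scalar loop has no offset: s = v2T x solves
    s = s (1 + alpha xi / theta), so s = 0 and then A0 x = 0. *)
Lemma Atilde_unitmx : prod_alpha != 0 -> xi != 0 -> At \in unitmx.
Proof.
move=> alpha_neq0 xi_neq0; rewrite -unitmx_tr -row_free_unit -kermx_eq0.
apply/eqP/row_matrixP => i; rewrite row0; set u := row i _.
have Atu : At *m u^T = 0.
  by apply/trmx_inj; rewrite trmx_mul trmxK -row_mul mulmx_ker row0 trmx0.
have A0u : A0 *m u^T + (v2T *m u^T) 0 0 *: v1 = 0.
  rewrite -[RHS]Atu [RHS]mulmxDl -(mulmxA v1) [v2T *m _ in RHS]mx11_scalar.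
  by rewrite mul_mx_scalar.
have /eqP := v2T_steady_state A0u; rewrite mulrDr mulr1 -subr_eq0 opprD addNKr.
rewrite oppr_eq0 !mulf_eq0 invr_eq0 (negPf alpha_neq0) (negPf xi_neq0).
rewrite (negPf theta_neq0) !orbF => /eqP s0.
move: A0u; rewrite s0 scale0r addr0 => A0u.
by rewrite -[u]trmxK -(mulKmx uA0 u^T) A0u mulmx0 trmx0.
Qed.

(** The only zero of the nominal field is the origin, which lies strictly on
    the nominal side as eta(0) = alpha d. *)
Lemma equilibriaE : 0 < prod_alpha * d ->
  equilibria A B c d alpha G K
    = [set 0] `|` [set x | At *m x = - bt /\ eta x < 0].
Proof.
move=> ad_gt0; apply/seteqP; split=> x; rewrite /equilibria /closed_loop /=.
  case: ifPn => [_ A0x | ]; first by left; rewrite -(mulKmx uA0 x) A0x mulmx0.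
  by rewrite -ltNge => eta_lt0 /eqP; rewrite addr_eq0 => /eqP; right.
case=> [-> | [Atx eta_lt0]].
  by rewrite /switching !mulmx0 mxE add0r ltW.
by rewrite leNgt eta_lt0 /= Atx addNr.
Qed.

End RelativeDegree.

End ClosedLoopTheory.

(** * Equilibria of the closed loop *)

Theorem proposition4 (R : realType) (n m r : nat)
    (A : 'M[R]_n.+1) (B : 'M[R]_(n.+1, m)) (c : 'cV[R]_n.+1) (d : R)
    (alpha : 'I_r -> R) (G : 'M[R]_m) (K : 'M[R]_(m, n.+1))
    (hAB : stabilizable A B)
    (hd : 0 < d)
    (hr : relative_degree A B c r)
    (halpha : forall j : 'I_r, 0 < alpha j)
    (hG : sym_posdef G)
    (hK : hurwitz (A0 A B K)) :
  let xi := xi r A B c G K in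
  let At := Atilde A B c alpha G K in
  let bt := btilde A B c d alpha G in
  let eta := switching A B c d alpha K in
  let E := equilibria A B c d alpha G K in
  let xs := - (invmx At *m bt) in
  (xi != 0 -> At \in unitmx /\ Num.sg (eta xs) = - Num.sg xi)
  /\ (xi != 0 ->
        (0 < eta xs <-> xi < 0) /\ (0 < eta xs -> E = [set 0]))
  /\ (xi != 0 ->
        (eta xs < 0 <-> 0 < xi) /\ (eta xs < 0 -> E = [set 0] `|` [set xs]))
  /\ (xi = 0 ->
        E = [set 0] `|` [set x | At *m x = - bt /\ eta x < 0]
        /\ (bt \in range (mulmx At) -> infinite_set E)
        /\ (bt \notin range (mulmx At) -> E = [set 0])).
Proof.
move=> xi At bt eta E xs.
have uA0 := hurwitz_unitmx hK.
have theta_pos := theta_gt0 hr hG.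
have theta_neq0 := lt0r_neq0 theta_pos.
have alpha_pos := alpha_prod_gt0 halpha.
have alpha_neq0 := lt0r_neq0 alpha_pos.
have unitAt : xi != 0 -> At \in unitmx by exact: Atilde_unitmx.
have eta_sol x : At *m x = - bt -> eta x * xi = - (d * theta r A B c G).
  move=> Atx; apply: (switching_filtered_zero hr uA0 theta_neq0 alpha_neq0).
  by rewrite -/At -/bt Atx addNr.
have EE : E = [set 0] `|` [set x | At *m x = - bt /\ eta x < 0].
  by apply: equilibriaE => //; rewrite mulr_gt0.
have solP x : xi != 0 -> At *m x = - bt <-> x = xs.
  move=> /unitAt uAt; split=> [Atx|->]; last by rewrite mulmxN mulKVmx.
  by rewrite -(mulKmx uAt x) Atx mulmxN.
have sg_xs : xi != 0 -> Num.sg (eta xs) = - Num.sg xi.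
  move=> xi_neq0; have := congr1 Num.sg (eta_sol xs ((solP xs xi_neq0).2 erefl)).
  rewrite sgrM sgrN (gtr0_sg (mulr_gt0 hd theta_pos)) => sgM.
  have sg_sqr : Num.sg xi * Num.sg xi = 1 by rewrite -expr2 sqr_sg xi_neq0.
  by rewrite -[LHS]mulr1 -sg_sqr mulrA sgM mulN1r.
split; first by move=> xi_neq0; split; [exact: unitAt | exact: sg_xs].
split.
  move=> xi_neq0; split.
    by rewrite -sgr_gt0 sg_xs // oppr_gt0 sgr_lt0.
  move=> eta_gt0; rewrite EE; apply/setUidl => x /= [/(solP x xi_neq0) -> ].
  by rewrite ltNge ltW.
split.
  move=> xi_neq0; split.
    by rewrite -sgr_lt0 sg_xs // oppr_lt0 sgr_gt0.
  move=> eta_lt0; rewrite EE; congr (_ `|` _); apply/seteqP.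
  split=> x /=; first by case=> /(solP x xi_neq0).
  by move=> ->; split=> //; apply/(solP _ xi_neq0).
move=> xi0.
have no_sol x : At *m x <> - bt.
  move=> /eta_sol/eqP; rewrite xi0 mulr0 eq_sym oppr_eq0 gt_eqF //.
  exact: mulr_gt0.
split=> //; split.
  (* The premise is contradictory: - y would be a zero of the filtered field. *)
  rewrite inE => -[y _ Aty]; case: (no_sol (- y)).
  by rewrite mulmxN Aty.
by move=> _; rewrite EE; apply/setUidl => x /= [/no_sol].
Qed.
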